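(* Let $(g,G,\mathbf p)_W$ be a local holomorphic deformation of a marked map $g$ with transfer operator $\mathcal A$. Assume that for any $r<j\le\nu$, $Dg^{q_j-l_j}(c_{l_j,j})\neq1$. Then the following statements are equivalent: (1) $1$ is an eigenvalue of $\mathcal A$; (2) $D\mathcal R(\mathbf c_1)$ is degenerate. More precisely, the dimension of the kernel of $D\mathcal R(\mathbf c_1)$ is equal to the dimension of the eigenspace of $\mathcal A$ associated with the eigenvalue $1$.
   Context: **Marked map.** A marked map is a map $g:P_0\cup U\to\mathbb C$, where $P_0\subset\mathbb C$ is finite and $U\subset\mathbb C$ is open, together with a finite set $P\supset P_0$ such that $g(P)\subset P$, $P\setminus P_0\subset U$, $g|_U$ is holomorphic and $g'(x)\ne 0$ for $x\in P\setminus P_0$. Write $P_0=\{c_{0,1},\dots,c_{0,\nu}\}$ (distinct points), $c_{n,j}=g^n(c_{0,j})$, $\mathbf c_0=(c_{0,j})_j$, $\mathbf c_1=(c_{1,j})_j$. **Local holomorphic deformation.** $(g,G,\mathbf p)_W$ consists of an open connected $W\subset\mathbb C^\nu$ containing $\mathbf c_1$, a holomorphic map $\mathbf p=(p_1,\dots,p_\nu):W\to\mathbb C^\nu$ with $\mathbf p(\mathbf c_1)=\mathbf c_0$, and a holomorphic map $G:W\times U\to\mathbb C$, $(w,z)\mapsto G_w(z)$, with $G_{\mathbf c_1}=g|_U$. **Critical relations.** For each $j$ exactly one of the following holds: (a) there are $q_j>0$ and $\mu(j)\in\{1,\dots,\nu\}$ with $g^{q_j}(c_{0,j})=c_{0,\mu(j)}$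 and $g^k(c_{0,j})\notin P_0$ for $1\le k<q_j$; (b) there are $1\le l_j<q_j$ with $g^{q_j}(c_{0,j})=g^{l_j}(c_{0,j})$ and $g^k(c_{0,j})\notin P_0$ for $1\le k\le q_j$. Fix such integers, and label so that (a) holds for $1\le j\le r$ and (b) for $r<j\le\nu$. Near $\mathbf c_1$ define $\mathcal R=(R_1,\dots,R_\nu)$ by $R_j(w)=G_w^{q_j-1}(w_j)-p_{\mu(j)}(w)$ for $1\le j\le r$ and $R_j(w)=G_w^{q_j-1}(w_j)-G_w^{l_j-1}(w_j)$ for $r<j\le\nu$. **Transfer operator.** A holomorphic motion $h_\lambda$ of $g(P)$ over $(\Lambda,0)$ is a family of injections $h_\lambda:g(P)\to\mathbb C$, $\lambda\in\Lambda$ (a domain containing $0$), holomorphic in $\lambda$ with $h_0=\mathrm{id}$. With $\mathbf c_1(\lambda)=(h_\lambda(c_{1,j}))_j$, its lift $\hat h_\lambda$ (defined for $\lambda$ near $0$) is the holomorphic motion of $g(P)$ with $\hat h_\lambda(c_{0,j})=p_j(\mathbf c_1(\lambda))$ for $c_{0,j}\in g(P)$ and $G_{\mathbf c_1(\lambda)}(\hat h_\lambda(x))=h_\lambda(g(x))$ for $x\in g(P)\setminus P_0$. $\mathcal A:\mathbb C^{\#g(P)}\to\mathbb C^{\#g(P)}$ is the linear map sending $\left\{\frac{d}{d\lambda}h_\lambda(x)|_{\lambda=0}\right\}_{x\in g(P)}$ to $\left\{\frac{d}{d\lambda}\hat h_\lambda(x)|_{\lambda=0}\right\}_{x\in g(P)}$.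 Explicitly, $(\mathcal Av)(c_{0,j})=\sum_k\frac{\partial p_j}{\partial w_k}(\mathbf c_1)v(c_{1,k})$ for $c_{0,j}\in g(P)$ and $(\mathcal Av)(x)=\frac1{g'(x)}\Big(v(g(x))-\sum_k\frac{\partial G_w(x)}{\partial w_k}\big|_{w=\mathbf c_1}v(c_{1,k})\Big)$ for $x\in g(P)\setminus P_0$.
   Formalization: The formal theorem additionally assumes that every cycle of g in P lying off the forward orbits of the points of P_0 has multiplier different from 1; without this the claim fails for large P. It is automatic when P is the union of the forward orbits of P_0. *)

(* Defs.v *)
From HB Require Import structures.
From mathcomp Require Import all_boot all_order all_algebra.
From mathcomp Require Import finmap complex.
From mathcomp Require Import all_classical all_reals all_analysis.

Set Implicit Arguments.
Unset Strict Implicit.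
Unset Printing Implicit Defensive.

Import Order.TTheory GRing.Theory Num.Theory numFieldNormedType.Exports.

Local Open Scope classical_set_scope.
Local Open Scope ring_scope.

(* The definitions below are stated over an arbitrary numClosedFieldType C, to
   which the library attaches a topology and a normed module structure over
   itself, so that [differentiable] means C-differentiable; they are meant
   to be used with C the field of complex numbers: *)
Definition Cplx (R : realType) : numClosedFieldType := R[i].

(* Partial functions are represented by total ones: the values of [mm_fun]
   outside P_0 `|` U, and below those of [df_G] and [df_p] outside W `*` U and
   W, are irrelevant and no field constrains them.  P_0 is the image of the
   injective labelling [mm_c0], whose indices are numbered from 0. *)
Record marked_map (C : numClosedFieldType) (nu : nat) := MarkedMap {
  mm_fun :> C -> C;
  mm_c0 : 'I_nu -> C;
  mm_U : set C;
  mm_P : {fset C};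
  mm_c0_inj : injective mm_c0;
  mm_U_open : open mm_U;
  mm_c0_P : forall j, mm_c0 j \in mm_P;
  mm_fun_P : forall x, x \in mm_P -> mm_fun x \in mm_P;
  mm_P_U : forall x, x \in mm_P -> (forall j, x <> mm_c0 j) -> mm_U x;
  mm_holo : forall x, mm_U x -> differentiable mm_fun x;
  mm_deriv : forall x, x \in mm_P -> (forall j, x <> mm_c0 j) ->
    derive1 mm_fun x != 0
}.

Section MarkedMap.
Variables (C : numClosedFieldType) (nu : nat) (g : marked_map C nu).

Definition in_P0 (x : C) : Prop := exists j, x = mm_c0 g j.

(* c_{n,j} and its vector of values (c_{n,j})_j *)
Definition orb (n : nat) (j : 'I_nu) : C := iter n g (mm_c0 g j).
Definition cvec (n : nat) : 'rV[C]_nu := \row_j orb n j.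

Definition gP : {fset C} := [fset g x | x in mm_P g]%fset.

Lemma c1_in_gP j : orb 1 j \in gP.
Proof. by apply/imfsetP; exists (mm_c0 g j) => //; exact: mm_c0_P. Qed.

Lemma g_in_gP (x : gP) : g (val x) \in gP.
Proof.
apply/imfsetP; exists (val x) => //=.
by have /imfsetP[y yP ->] := valP x; exact: mm_fun_P.
Qed.

Definition c1pt (j : 'I_nu) : gP := [` c1_in_gP j]%fset.
Definition gpt (x : gP) : gP := [` g_in_gP x]%fset.

Definition exact_period (m : nat) (x : C) : Prop :=
  [/\ (0 < m)%N, iter m g x = x &
      forall k, (0 < k < m)%N -> iter k g x <> x].

(* P is allowed to be larger than the forward orbit of P_0.  The condition says
   that the cycles of g in P lying off that orbit, if any, have multiplier
   different from 1.  Such a cycle is invisible to the critical relations, but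
   if its multiplier is 1 then the transfer operator has 1 as an eigenvalue,
   with an eigenvector supported on the points of g(P) that g eventually maps
   to the cycle. *)
Definition extra_cycles_nonparabolic : Prop :=
  forall (m : nat) (x : C), x \in mm_P g -> (forall n j, x <> orb n j) ->
    exact_period m x -> derive1 (iter m g) x != 1.

Lemma orbit_extra_cycles_nonparabolic :
  (forall x, x \in mm_P g -> exists n j, x = orb n j) ->
  extra_cycles_nonparabolic.
Proof. by move=> H m x /H[n [j xE]] /(_ n j xE). Qed.

End MarkedMap.

Record deformation (C : numClosedFieldType) (nu : nat) (g : marked_map C nu) :=
  Deformation {
  df_W : set 'rV[C]_nu;
  df_G : 'rV[C]_nu -> C -> C;
  df_p : 'rV[C]_nu -> 'rV[C]_nu;
  df_W_open : open df_W;
  df_W_conn : connected df_W;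
  df_W_c1 : df_W (cvec g 1);
  df_p_holo : forall w, df_W w -> differentiable df_p w;
  df_p_c1 : df_p (cvec g 1) = cvec g 0;
  df_G_holo : forall w z, df_W w -> mm_U g z ->
    differentiable (fun y : 'rV[C]_nu * C => df_G y.1 y.2) (w, z);
  df_G_c1 : forall z, mm_U g z -> df_G (cvec g 1) z = g z
}.

(* Indices start from 0, so type (a) is j < r and type (b) is r <= j. *)
Record critical_relations (C : numClosedFieldType) (nu : nat)
    (g : marked_map C nu) (r : nat) (q l : 'I_nu -> nat)
    (mu : 'I_nu -> 'I_nu) : Prop := CriticalRelations {
  cr_r : (r <= nu)%N;
  cr_a : forall j : 'I_nu, (j < r)%N ->
    [/\ (0 < q j)%N, orb g (q j) j = mm_c0 g (mu j) &
        forall k, (1 <= k < q j)%N -> ~ in_P0 g (orb g k j)];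
  cr_b : forall j : 'I_nu, (r <= j)%N ->
    [/\ (1 <= l j < q j)%N, orb g (q j) j = orb g (l j) j &
        forall k, (1 <= k <= q j)%N -> ~ in_P0 g (orb g k j)]
}.

Lemma affine_aux (K : comPzRingType) (a d s t s' t' : K) :
  d * (a * s + t - (a * s' + t')) = a * (d * (s - s')) + d * (t - t').
Proof.
by rewrite mulrCA -mulrDr; congr (_ * _); rewrite mulrBr opprD addrACA.
Qed.

Lemma solve_aux (K : fieldType) (d s t : K) :
  d != 0 -> d^-1 * (s + t * d - s) = t.
Proof. by move=> d0; rewrite [s + _]addrC addrK mulrC mulfK. Qed.

Lemma diff_coord (K : numFieldType) m n (M N : 'M[K]_(m, n)) i j :
  'd (fun A : 'M[K]_(m, n) => A i j : K) M N = N i j.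
Proof.
have @f : {linear 'M[K]_(m, n) -> K}.
  by exists (fun N : 'M[K]_(_, _) => N i j); do 2![eexists]; do ?[constructor];
     rewrite ?mxE// => ? *; rewrite ?mxE//; move=> ?; rewrite !mxE.
by rewrite (_ : (fun _ => _) = f) // diff_lin//; exact: coord_continuous.
Qed.

Lemma derive1_comp_diff (K : numFieldType) (V W : normedModType K)
    (f : V -> W) (e : K -> V) t y : e t = y -> differentiable e t ->
  differentiable f y -> derive1 (f \o e) t = 'd f y ('d e t 1).
Proof.
move=> <- ed fd; rewrite derive1E'; last exact: differentiable_comp.
by rewrite diff_comp.
Qed.

Lemma near_eq_derive1 (K : numFieldType) (V : normedModType K)
    (e f : K -> V) t : (\near t, e t = f t) -> derive1 e t = derive1 f t.
Proof. by move=> ef; rewrite !derive1E; exact: near_eq_derive. Qed.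

Section Deformation.
Variables (C : numClosedFieldType) (nu : nat) (g : marked_map C nu).
Variable D : deformation g.
Local Notation c1 := (cvec g 1).

Definition Rmap (r : nat) (q l : 'I_nu -> nat) (mu : 'I_nu -> 'I_nu)
    (w : 'rV[C]_nu) : 'rV[C]_nu :=
  \row_j (if (j < r)%N
          then iter (q j).-1 (df_G D w) (w 0 j) - df_p D w 0 (mu j)
          else iter (q j).-1 (df_G D w) (w 0 j)
               - iter (l j).-1 (df_G D w) (w 0 j)).

Definition dw (k : 'I_nu) (f : 'rV[C]_nu -> C) : C :=
  'D_(delta_mx 0 k) f c1.

Definition transfer_fun (v : {ffun gP g -> C}) : {ffun gP g -> C} :=
  [ffun x : gP g =>
    if [pick j | val x == mm_c0 g j] is Some j
    then \sum_k dw k (fun w => df_p D w 0 j) * v (c1pt g k)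
    else (derive1 g (val x))^-1 *
         (v (gpt x) - \sum_k dw k (fun w => df_G D w (val x)) * v (c1pt g k))].

Lemma transfer_fun_is_linear : linear transfer_fun.
Proof.
move=> a u v.
have S (f : 'I_nu -> C) : \sum_k f k * (a *: u + v) (c1pt g k) =
    a * (\sum_k f k * u (c1pt g k)) + \sum_k f k * v (c1pt g k).
  rewrite mulr_sumr -big_split; apply: eq_bigr => k _ /=.
  by rewrite !ffunE mulrDr; congr (_ + _); exact: mulrCA.
apply/ffunP => x; rewrite ffunE S [in RHS]ffunE [in RHS]ffunE.
rewrite [X in _ = _ *: X + _]ffunE [X in _ = _ + X]ffunE.
case: pickP => [j _|_]; first by rewrite S.
have -> : (a *: u + v) (gpt x) = a * u (gpt x) + v (gpt x) by rewrite !ffunE.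
exact: affine_aux.
Qed.

HB.instance Definition _ :=
  GRing.isLinear.Build C {ffun gP g -> C} {ffun gP g -> C} _ transfer_fun
    transfer_fun_is_linear.

Definition transfer_op : 'End({ffun gP g -> C}) := linfun transfer_fun.

Lemma transfer_opE v : transfer_op v = transfer_fun v.
Proof. by rewrite lfunE. Qed.


(* [transfer_op] is given by its matrix formula; [transfer_op_lift] below shows
   that it sends the velocity at 0 of any holomorphic motion of g(P) to the
   velocity at 0 of its lift. *)
Record holomorphic_motion (L : set C) (h : C -> gP g -> C) : Prop :=
  HolomorphicMotion {
  hm_open : open L;
  hm_conn : connected L;
  hm_0 : L 0;
  hm_id : forall x, h 0 x = val x;
  hm_inj : forall t, L t -> injective (h t);
  hm_holo : forall t x, L t -> differentiable (h ^~ x) t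
}.

Definition motion_c1 (h : C -> gP g -> C) (t : C) : 'rV[C]_nu :=
  \row_j h t (c1pt g j).

Definition velocity (h : C -> gP g -> C) : {ffun gP g -> C} :=
  [ffun x => derive1 (h ^~ x) 0].

Definition is_lift (h hh : C -> gP g -> C) : Prop :=
  exists2 L : set C, holomorphic_motion L hh & forall t, L t ->
    [/\ df_W D (motion_c1 h t),
        forall x j, val x = mm_c0 g j -> hh t x = df_p D (motion_c1 h t) 0 j &
        forall x, ~ in_P0 g (val x) ->
          mm_U g (hh t x) /\ df_G D (motion_c1 h t) (hh t x) = h t (gpt x)].

Lemma motion_c1_0 L h : holomorphic_motion L h -> motion_c1 h 0 = c1.
Proof. by move=> [_ _ _ h0 _ _]; apply/rowP => j; rewrite !mxE h0. Qed.

Lemma motion_c1E h :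
  motion_c1 h = \sum_(k < nu) (fun t => h t (c1pt g k) *: delta_mx 0 k).
Proof.
apply/funext => t; rewrite [LHS](row_sum_delta (motion_c1 h t)) fct_sumE.
by apply: eq_bigr => k _; rewrite mxE.
Qed.

Lemma motion_c1_diff L h : holomorphic_motion L h ->
  differentiable (motion_c1 h) 0.
Proof.
move=> [_ _ L0 _ _ hd]; rewrite motion_c1E; apply: differentiable_sum => k.
exact/differentiableZl/hd.
Qed.

Lemma motion_c1_D L h : holomorphic_motion L h ->
  'd (motion_c1 h) 0 1 = \row_j velocity h (c1pt g j).
Proof.
move=> hm; have md := motion_c1_diff hm; have [_ _ L0 _ _ hd] := hm.
apply/rowP => j; rewrite mxE ffunE derive1E.
rewrite (_ : h ^~ _ = (fun N : 'rV[C]_nu => N 0 j) \o motion_c1 h); last first.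
  by apply/funext => t; rewrite /= mxE.
rewrite deriveE; last exact/differentiable_comp/differentiable_coord.
rewrite diff_comp//; last exact: differentiable_coord.
by rewrite /= diff_coord.
Qed.

Lemma dwE (f : 'rV[C]_nu -> C) (v : 'rV[C]_nu) : differentiable f c1 ->
  'd f c1 v = \sum_k dw k f * v 0 k.
Proof.
move=> fd; rewrite [in LHS](row_sum_delta v) linear_sum; apply: eq_bigr => k _.
by rewrite linearZ /= /dw deriveE// mulrC.
Qed.

Lemma transfer_op_lift L h hh : holomorphic_motion L h -> is_lift h hh ->
  transfer_op (velocity h) = velocity hh.
Proof.
move=> hm [M hhm MP]; rewrite transfer_opE; apply/ffunP => x; rewrite !ffunE.
have M0 : \forall t \near (0 : C), M t.
  by apply: open_nbhs_nbhs; split; [exact: hm_open hhm | exact: hm_0 hhm].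
have md := motion_c1_diff hm; have m0 := motion_c1_0 hm.
have mD := motion_c1_D hm.
have hhd : differentiable (hh ^~ x) 0 by exact: hm_holo hhm _ _ (hm_0 hhm).
case: pickP => [j /eqP xj|xP0].
  have pd : differentiable (fun w => df_p D w 0 j) c1.
    apply: (@differentiable_comp _ _ _ _ (df_p D) (fun N : 'rV_nu => N 0 j)).
      exact/df_p_holo/df_W_c1.
    exact: differentiable_coord.
  rewrite (@near_eq_derive1 _ _ _ ((fun w => df_p D w 0 j) \o motion_c1 h)).
    rewrite (derive1_comp_diff m0 md pd) dwE// mD.
    by apply: eq_bigr => k _; rewrite mxE.
  near=> t; have Mt : M t by near: t.
  by have [_ + _] := MP t Mt; apply.
have xnP0 : ~ in_P0 g (val x).
  by move=> [j xj]; have := xP0 j; rewrite xj eqxx.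
have xP : val x \in mm_P g.
  by have /imfsetP[y yP ->] := valP x; exact: mm_fun_P.
have xU : mm_U g (val x).
  by apply: mm_P_U => // j xj; apply: xnP0; exists j.
have gx0 : derive1 g (val x) != 0.
  by apply: mm_deriv => // j xj; apply: xnP0; exists j.
pose Gu := fun y : 'rV[C]_nu * C => df_G D y.1 y.2.
have Gd : differentiable Gu (c1, val x) by apply: df_G_holo => //; exact: df_W_c1.
pose e t := (motion_c1 h t, hh t x).
have e0 : e 0 = (c1, val x) by rewrite /e m0 (hm_id hhm).
have ed : differentiable e 0 by exact: differentiable_pair.
have vE : velocity h (gpt x) = 'd Gu (c1, val x) ('d e 0 1).
  rewrite ffunE -(derive1_comp_diff e0 ed Gd); apply: near_eq_derive1.
  near=> t; have Mt : M t by near: t.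
  by have [_ _ /(_ x xnP0)[_ <-]] := MP t Mt.
have deE : 'd e 0 1 =
    ('d (motion_c1 h) 0 1, 0) + (0, derive1 (hh ^~ x) 0) :> 'rV[C]_nu * C.
  rewrite /e diff_pair//= derive1E'//.
  by congr (_, _); rewrite ?addr0 ?add0r.
have pairwd w : differentiable (fun w : 'rV[C]_nu => (w, val x)) w.
  exact: (@differentiable_pair _ _ _ _ id (cst (val x))).
have Gwd : differentiable (fun w => df_G D w (val x)) c1.
  exact: (@differentiable_comp _ _ _ _ (fun w => (w, val x)) Gu).
have Gw u : 'd Gu (c1, val x) (u, 0) = 'd (fun w => df_G D w (val x)) c1 u.
  have := @diff_comp _ _ _ _ (fun w => (w, val x)) Gu c1 (pairwd c1) Gd.
  move=> /(congr1 (fun f => f u)) /= ->.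
  rewrite (@diff_pair _ _ _ _ id (cst (val x)))//=.
  by rewrite diff_val diff_cst.
have pairzd z : differentiable (fun z : C => (c1, z)) z.
  exact: (@differentiable_pair _ _ _ _ (cst c1) id).
have Gz s : 'd Gu (c1, val x) (0, s) = s * derive1 g (val x).
  have -> : derive1 g (val x) = derive1 (Gu \o (fun z => (c1, z))) (val x).
    apply: near_eq_derive1; near=> z; rewrite /Gu/= df_G_c1//.
    by near: z; apply: open_nbhs_nbhs; split; [exact: mm_U_open|].
  rewrite (derive1_comp_diff _ (pairzd _) Gd)// (@diff_pair _ _ _ _ (cst c1) id)//.
  rewrite (_ : (0, s) = s *: (0, 1) :> 'rV[C]_nu * C); last first.
    by congr (_, _); [rewrite scaler0 | exact/esym/mulr1].
  by rewrite linearZ /= !diff_val.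
have hx' : velocity h (gpt x) =
    (\sum_k dw k (fun w => df_G D w (val x)) * velocity h (c1pt g k)) +
    derive1 (hh ^~ x) 0 * derive1 g (val x).
  rewrite vE deE linearD Gw Gz dwE// mD; congr (_ + _).
  by apply: eq_bigr => k _; rewrite mxE.
have -> : derive1 (h ^~ (gpt x)) 0 = velocity h (gpt x) by rewrite ffunE.
by rewrite hx'; exact: solve_aux.
Unshelve. all: by end_near. Qed.
End Deformation.

(* Main.v *)
(* Prescribe a velocity V of the critical values and look for a velocity v of
   the points of g(P) obtained from it by lifting:
     v(c_{0,j}) = dp_j(V),  v(g(x)) = dG(x)(V) + g'(x) v(x) for x off P_0.
   The homogeneous system is injective in v: along a solution v the values are
   multiplied by g', so v(x) <> 0 forces the orbit of x to avoid P_0 and to end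
   in a cycle of multiplier 1, which the hypotheses exclude.  As the system is
   square, v exists and is unique for each V.  The fixed vectors of the transfer
   operator are therefore the v whose values at the c_{1,k} give back V.

   The difference between the derivative of G_w^n(w_j) in the direction V and
   v(c_{n+1,j}) also gets multiplied by g' at each step, so DR_j(V) is this
   difference at n = 0 times (g^{q_j-1})'(c_{1,j}) in case (a), and times
   ((g^{q_j-l_j})'(c_{l_j,j}) - 1) (g^{l_j-1})'(c_{1,j}) in case (b).  These
   factors are nonzero, so DR(V) = 0 if and only if V is the vector of the
   v(c_{1,k}). *)

Require Import Defs.
From HB Require Import structures.
From mathcomp Require Import all_boot all_order all_algebra.
From mathcomp Require Import finmap complex.
From mathcomp Require Import all_classical all_reals all_analysis.
Import Order.TTheory GRing.Theory Num.Theory numFieldNormedType.Exports.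
Local Open Scope classical_set_scope.
Local Open Scope ring_scope.

(** * One-variable derivatives *)

Lemma diff_derive1 (C : numFieldType) (V : normedModType C) (f : C -> V)
    (x s : C) : differentiable f x -> 'd f x s = s *: derive1 f x.
Proof. by move=> fd; rewrite derive1E' // -[in LHS](mulr1 s) linearZ. Qed.

Lemma derive1_comp_scalar (C : numFieldType) (e f : C -> C) (x : C) :
  differentiable e x -> differentiable f (e x) ->
  derive1 (f \o e) x = derive1 f (e x) * derive1 e x.
Proof.
move=> ed fd.
have -> : derive1 (f \o e) x = 'd f (e x) ('d e x 1).
  exact: (derive1_comp_diff erefl ed fd).
by rewrite (@diff_derive1 _ _ f _ _ fd) -(derive1E' ed); exact: mulrC.
Qed.

(** * Orbits of [g] and the chain rule along them *)

Section Orbits.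
Set Implicit Arguments.
Unset Strict Implicit.
Variables (C : numClosedFieldType) (nu : nat) (g : marked_map C nu).
Implicit Types (x y : gP g) (z : C).

Lemma mem_gP_P x : val x \in mm_P g.
Proof. by have /imfsetP[y yP ->] := valP x; exact: mm_fun_P. Qed.

Lemma orb_P n j : orb g n j \in mm_P g.
Proof. by elim: n => [|n IHn]; [exact: mm_c0_P | exact: mm_fun_P]. Qed.

Lemma orb_iter m n j : iter m g (orb g n j) = orb g (m + n) j.
Proof. by rewrite /orb iterD. Qed.

Lemma val_iter_gpt n x : val (iter n (@gpt C nu g) x) = iter n g (val x).
Proof. by elim: n => //= n <-. Qed.

Lemma val_iter_gpt_c1pt n j :
  val (iter n (@gpt C nu g) (c1pt g j)) = orb g n.+1 j.
Proof. by rewrite val_iter_gpt -addn1 -orb_iter. Qed.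

Lemma off_P0_U z : z \in mm_P g -> ~ in_P0 g z -> mm_U g z.
Proof. by move=> zP zP0; apply: mm_P_U => // j zj; apply: zP0; exists j. Qed.

Lemma off_P0_deriv z : z \in mm_P g -> ~ in_P0 g z -> derive1 g z != 0.
Proof. by move=> zP zP0; apply: mm_deriv => // j zj; apply: zP0; exists j. Qed.

Lemma iter_differentiable n z : (forall i, (i < n)%N -> mm_U g (iter i g z)) ->
  differentiable (iter n g : C -> C) z.
Proof.
elim: n => [|n IHn] zU; first exact: ex_diff.
rewrite (_ : iter n.+1 g = g \o iter n g) //; apply: differentiable_comp.
  by apply: IHn => i /ltnW; exact: zU.
by apply/mm_holo/zU.
Qed.

Lemma derive1_iterS n z : (forall i, (i <= n)%N -> mm_U g (iter i g z)) ->
  derive1 (iter n.+1 g) z = derive1 g (iter n g z) * derive1 (iter n g) z.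
Proof.
move=> zU; rewrite (_ : iter n.+1 g = g \o iter n g) //.
rewrite derive1_comp_scalar //; last exact/mm_holo/zU.
by apply: iter_differentiable => i /ltnW; exact: zU.
Qed.

(** Both sides obey the same recursion by the chain rule. This turns step-by-step multiplication by
    g' into a single multiplier, for the homogeneous solutions below and later for [gap]. *)
Lemma cocycle_derive1 (d : nat -> C) z n :
  (forall i, (i < n)%N -> mm_U g (iter i g z)) ->
  (forall i, (i < n)%N -> d i.+1 = derive1 g (iter i g z) * d i) ->
  d n = derive1 (iter n g) z * d 0%N.
Proof.
elim: n => [|n IHn] zU dS; first by rewrite derive1E derive_id mul1r.
rewrite dS // derive1_iterS; last by move=> i; exact: zU.
by rewrite -mulrA -IHn // => i /ltnW; [exact: zU | exact: dS].
Qed.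

Lemma derive1_iter_neq0 n z : z \in mm_P g ->
  (forall i, (i < n)%N -> ~ in_P0 g (iter i g z)) -> derive1 (iter n g) z != 0.
Proof.
move=> zP; have iP i : iter i g z \in mm_P g.
  by elim: i => //= i; exact: mm_fun_P.
elim: n => [|n IHn] nP0; first by rewrite derive1E derive_id oner_neq0.
rewrite derive1_iterS; last by move=> i iN; exact/off_P0_U/nP0.
rewrite mulf_neq0 ?off_P0_deriv //; first exact: nP0.
by apply: IHn => i /ltnW; exact: nP0.
Qed.

End Orbits.

(** * Vanishing of solutions of the homogeneous lifting equations *)

Section Rigidity.
Set Implicit Arguments.
Unset Strict Implicit.
Variables (C : numClosedFieldType) (nu : nat) (g : marked_map C nu).
Variables (r : nat) (q l : 'I_nu -> nat) (mu : 'I_nu -> 'I_nu).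
Hypothesis crit : critical_relations g r q l mu.
Hypothesis extra : extra_cycles_nonparabolic g.
Hypothesis mult : forall j : 'I_nu, (r <= j)%N ->
  derive1 (iter (q j - l j) g) (orb g (l j) j) != 1.
Implicit Types x y : gP g.
Local Notation gamma := (@gpt C nu g).

Variable v : gP g -> C.
Hypothesis v_P0 : forall x, in_P0 g (val x) -> v x = 0.
Hypothesis v_off : forall x, ~ in_P0 g (val x) ->
  v (gamma x) = derive1 g (val x) * v x.

Lemma neq0_off_P0 x : v x != 0 -> ~ in_P0 g (val x).
Proof. by move=> vx /v_P0 vx0; rewrite vx0 eqxx in vx. Qed.

(** A nonzero value forces the point off P_0, where g' does not vanish on P, so nonvanishing
    propagates forward. *)
Lemma iter_neq0 n x : v x != 0 -> v (iter n gamma x) != 0.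
Proof.
move=> vx; elim: n => //= n IHn; have xP0 := neq0_off_P0 IHn.
by rewrite v_off // mulf_neq0 // off_P0_deriv // mem_gP_P.
Qed.

(** On return the value v(x) has been multiplied by the multiplier of the loop; as v(x) is nonzero
    it can be cancelled. *)
Lemma return_derive1 n x : v x != 0 -> iter n gamma x = x ->
  derive1 (iter n g) (val x) = 1.
Proof.
move=> vx nx; apply: (mulIf vx); rewrite mul1r -[RHS](congr1 v nx).
apply/esym/(@cocycle_derive1 _ _ _ (fun i => v (iter i gamma x))) => i _;
  rewrite -val_iter_gpt; have iP0 := neq0_off_P0 (iter_neq0 i vx).
  exact/off_P0_U/iP0/mem_gP_P.
exact: v_off.
Qed.

(** Strong induction on n. In case (a) the orbit either still has to meet P_0, where [v] vanishes,
    or has passed c_{0,mu(j)} and is a shorter orbit starting there. In case (b) it reaches the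
    cycle of c_{l_j,j}, whose multiplier would have to be 1. *)
Lemma neq0_off_orbits x n j : v x != 0 -> val x <> orb g n j.
Proof.
move=> vx; elim/ltn_ind: n j => n IHn j xn.
have [jr|rj] := ltnP j r.
  have [q0 qE _] := cr_a crit jr; have [nq|qn] := ltnP n (q j).
    apply: (neq0_off_P0 (iter_neq0 (q j - n) vx)); exists (mu j).
    by rewrite val_iter_gpt xn orb_iter subnK // ltnW.
  apply: (IHn (n - q j)%N _ (mu j)).
    by rewrite ltn_subrL q0 (leq_trans q0 qn).
  by rewrite xn -{1}(subnK qn) -orb_iter qE.
have [/andP[_ lq] qE _] := cr_b crit rj.
have lE k : orb g (k * (q j - l j) + l j) j = orb g (l j) j.
  elim: k => // k IHk.
  by rewrite mulSn -addnA -orb_iter IHk orb_iter subnK // ltnW.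
(* After n turns of length q_j - l_j the time is at least n, so the subtraction is exact and [y]
   lands on c_{l_j,j}. *)
pose y := iter (n * (q j - l j) + l j - n) gamma x.
have yE : val y = orb g (l j) j.
  rewrite val_iter_gpt xn orb_iter subnK ?lE // (leq_trans _ (leq_addr _ _)) //.
  by rewrite leq_pmulr // subn_gt0.
have /eqP[] := mult rj; rewrite -yE; apply: return_derive1.
  exact: iter_neq0.
by apply: val_inj; rewrite val_iter_gpt yE orb_iter subnK // ltnW.
Qed.

Lemma rigidity x : v x = 0.
Proof.
apply/eqP/negPn/negP => vx.
(* g(P) is finite, so the orbit of [x] runs into a cycle, entered by time [a]. *)
have /loopingP/(_ (order gamma x))/trajectP[a alt aE] := looping_order gamma x.
pose y := iter a gamma x; have vy : v y != 0 by exact: iter_neq0.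
have ex_m : exists m, (0 < m)%N && (iter m gamma y == y).
  exists (order gamma x - a)%N; rewrite subn_gt0 alt /= /y -iterD subnK ?aE //.
  exact: ltnW.
(* The least return time is the exact period required by [extra]. *)
case: (ex_minnP ex_m) => m /andP[m0 /eqP my] mmin.
have /eqP[] : derive1 (iter m g) (val y) != 1; last exact: return_derive1.
apply: extra; first exact: mem_gP_P.
  by move=> n j; exact: neq0_off_orbits.
split=> //; first by rewrite -val_iter_gpt my.
move=> k /andP[k0 km]; rewrite -val_iter_gpt => /val_inj ky.
by have := mmin k; rewrite k0 ky eqxx leqNgt km => /(_ isT).
Qed.

End Rigidity.

(** * Derivatives at c_1 and the lifting equations *)

Section Linearization.
Set Implicit Arguments.
Unset Strict Implicit.
Variables (C : numClosedFieldType) (nu : nat) (g : marked_map C nu).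
Variable D : deformation g.
Local Notation c1 := (cvec g 1).
Local Notation gamma := (@gpt C nu g).
Implicit Types (x : gP g) (z : C) (V : 'rV[C]_nu) (v : {ffun gP g -> C}).

Definition Gdot z V : C := 'd (fun w => df_G D w z : C) c1 V.
Definition pdot j V : C := 'd (fun w => df_p D w 0 j : C) c1 V.

Lemma p_coord_differentiable j : differentiable (fun w => df_p D w 0 j : C) c1.
Proof.
apply: (@differentiable_comp _ _ _ _ (df_p D) (fun N : 'rV_nu => N 0 j)).
  exact/df_p_holo/df_W_c1.
exact: differentiable_coord.
Qed.

Lemma G_section_differentiable z : mm_U g z ->
  differentiable (fun w => df_G D w z : C) c1.
Proof.
move=> zU; apply: (@differentiable_comp _ _ _ _ (fun w : 'rV[C]_nu => (w, z))
  (fun y : 'rV[C]_nu * C => df_G D y.1 y.2)).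
  exact: (@differentiable_pair _ _ _ _ id (cst z)).
exact/df_G_holo/zU/df_W_c1.
Qed.

(* The two partial differentials of (w, z) |-> G_w(z) are isolated by
   restricting it to the slices w |-> (w, z) and z |-> (c1, z). *)
Lemma diff_G z V s : mm_U g z ->
  'd (fun y : 'rV[C]_nu * C => df_G D y.1 y.2 : C) (c1, z) (V, s) =
  Gdot z V + derive1 g z * s.
Proof.
move=> zU; set Gu := fun y : 'rV[C]_nu * C => df_G D y.1 y.2 : C.
have Gd : differentiable Gu (c1, z) by exact/df_G_holo/zU/df_W_c1.
have wd : differentiable (fun w : 'rV[C]_nu => (w, z)) c1.
  exact: (@differentiable_pair _ _ _ _ id (cst z)).
have zd : differentiable (fun y : C => (c1, y)) z.
  exact: (@differentiable_pair _ _ _ _ (cst c1) id).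
have -> : (V, s) = (V, 0) + (0, s) :> 'rV[C]_nu * C.
  by congr (_, _); rewrite ?addr0 ?add0r.
rewrite linearD; congr (_ + _).
  rewrite /Gdot (@diff_comp _ _ _ _ (fun w => (w, z)) Gu c1 wd Gd) /=.
  by rewrite (@diff_pair _ _ _ _ id (cst z)) //= diff_val diff_cst.
have -> : derive1 g z = derive1 (Gu \o (fun y => (c1, y))) z.
  (* G_{c_1} is known to agree with g only on U, which is a neighbourhood of z. *)
  apply: near_eq_derive1; near=> y; rewrite /Gu /= df_G_c1 //.
  by near: y; apply: open_nbhs_nbhs; split; [exact: mm_U_open|].
rewrite (derive1_comp_diff erefl zd Gd) (@diff_pair _ _ _ _ (cst c1) id) //=.
rewrite (_ : (0, s) = s *: (0, 1) :> 'rV[C]_nu * C); last first.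
  by congr (_, _); [rewrite scaler0 | exact/esym/mulr1].
by rewrite linearZ /= !diff_val; exact: mulrC.
Unshelve. all: by end_near. Qed.

Lemma diff_G_comp (f : 'rV[C]_nu -> C) V :
  mm_U g (f c1) -> differentiable f c1 ->
  differentiable (fun w => df_G D w (f w) : C) c1 /\
  'd (fun w => df_G D w (f w) : C) c1 V =
    Gdot (f c1) V + derive1 g (f c1) * 'd f c1 V.
Proof.
move=> fU fd; set Gu := fun y : 'rV[C]_nu * C => df_G D y.1 y.2 : C.
have Gd : differentiable Gu (c1, f c1) by exact/df_G_holo/fU/df_W_c1.
have ed : differentiable (fun w : 'rV[C]_nu => (w, f w)) c1.
  exact: (@differentiable_pair _ _ _ _ id f).
split; first exact: (differentiable_comp ed Gd).
have -> : 'd (fun w => df_G D w (f w) : C) c1 V =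
    'd Gu (c1, f c1) ('d (fun w : 'rV[C]_nu => (w, f w)) c1 V).
  by rewrite -/(Gu \o (fun w => (w, f w))) diff_comp.
by rewrite (@diff_pair _ _ _ _ id f) //= diff_val diff_G.
Qed.

(* Indices are shifted by one: at w = c_1 this is c_{n+1,j}. *)
Definition critical_orbit n (j : 'I_nu) (w : 'rV[C]_nu) : C :=
  iter n (df_G D w) (w 0 j).

(** Each point to which G_{c_1} is applied lies off P_0, hence in U, where G_{c_1} = g. *)
Lemma critical_orbit_c1 n j :
  (forall k, (1 <= k <= n)%N -> ~ in_P0 g (orb g k j)) ->
  critical_orbit n j c1 = orb g n.+1 j.
Proof.
elim: n => [|n IHn] nP0; first by rewrite /critical_orbit /= mxE.
rewrite /critical_orbit iterS -/(critical_orbit n j c1) IHn; last first.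
  by move=> k /andP[k0 kn]; apply: nP0; rewrite k0 ltnW.
rewrite df_G_c1 //; apply: off_P0_U; first exact: orb_P.
by apply: nP0; rewrite leqnn.
Qed.

Lemma critical_orbit_U n j :
  (forall k, (1 <= k <= n.+1)%N -> ~ in_P0 g (orb g k j)) ->
  mm_U g (critical_orbit n j c1).
Proof.
move=> nP0; rewrite critical_orbit_c1; last first.
  by move=> k /andP[k0 kn]; apply: nP0; rewrite k0 ltnW.
by apply: off_P0_U; [exact: orb_P | apply: nP0; rewrite leqnn].
Qed.

Lemma critical_orbit_differentiable n j :
  (forall k, (1 <= k <= n)%N -> ~ in_P0 g (orb g k j)) ->
  differentiable (critical_orbit n j) c1.
Proof.
elim: n => [|n IHn] nP0; first exact: differentiable_coord.
have nP0' k : (1 <= k <= n)%N -> ~ in_P0 g (orb g k j).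
  by move=> /andP[k0 kn]; apply: nP0; rewrite k0 ltnW.
by have [] := diff_G_comp 0 (critical_orbit_U nP0) (IHn nP0').
Qed.

Lemma diff_critical_orbitS n j V :
  (forall k, (1 <= k <= n.+1)%N -> ~ in_P0 g (orb g k j)) ->
  'd (critical_orbit n.+1 j) c1 V =
  Gdot (orb g n.+1 j) V + derive1 g (orb g n.+1 j) * 'd (critical_orbit n j) c1 V.
Proof.
move=> nP0; have nP0' k : (1 <= k <= n)%N -> ~ in_P0 g (orb g k j).
  by move=> /andP[k0 kn]; apply: nP0; rewrite k0 ltnW.
have [_] := diff_G_comp V (critical_orbit_U nP0)
  (critical_orbit_differentiable nP0').
by rewrite critical_orbit_c1.
Qed.

(* [v] is the velocity of a motion of g(P) lifted from a variation of the
   critical values with velocity [V]: the fixed points of the transfer operator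
   are the [v] lifted from their own values at the c_{1,k}. *)
Definition lifted_velocity v V : Prop :=
  (forall x j, val x = mm_c0 g j -> v x = pdot j V) /\
  (forall x, ~ in_P0 g (val x) ->
     v (gamma x) = Gdot (val x) V + derive1 g (val x) * v x).

(** This map will restrict to an isomorphism from the fixed space of the transfer operator onto the
    kernel of DR. *)
Definition critical_values v : 'rV[C]_nu := \row_k v (c1pt g k).

Lemma critical_values_is_linear : linear critical_values.
Proof. by move=> a u v; apply/rowP => k; rewrite !mxE !ffunE. Qed.

HB.instance Definition _ :=
  GRing.isLinear.Build C {ffun gP g -> C} 'rV[C]_nu _ critical_values
    critical_values_is_linear.

Lemma transfer_op_fixP v :
  transfer_op D v = v <-> lifted_velocity v (critical_values v).
Proof.
have pE j : \sum_k dw g k (fun w => df_p D w 0 j) * v (c1pt g k) =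
    pdot j (critical_values v).
  rewrite /pdot dwE; last exact: p_coord_differentiable.
  by apply: eq_bigr => k _; rewrite mxE.
have GE x : ~ in_P0 g (val x) ->
    \sum_k dw g k (fun w => df_G D w (val x)) * v (c1pt g k) =
    Gdot (val x) (critical_values v).
  move=> xP0; rewrite /Gdot dwE; first by apply: eq_bigr => k _; rewrite mxE.
  exact/G_section_differentiable/off_P0_U/xP0/mem_gP_P.
rewrite transfer_opE; split=> [Av|[vp vG]].
  split=> [x j xj|x xP0]; have := congr1 (fun f : {ffun _ -> _} => f x) Av;
    rewrite ffunE; case: pickP => [i /eqP xi|xN] vx.
  - by rewrite -vx pE; congr pdot; apply: (@mm_c0_inj _ _ g); rewrite -xi.
  - by have := xN j; rewrite xj eqxx.
  - by case: xP0; exists i.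
  rewrite -vx GE // mulVKf ?off_P0_deriv ?mem_gP_P //.
  by rewrite addrC subrK.
apply/ffunP => x; rewrite ffunE; case: pickP => [j /eqP xj|xN].
  by rewrite pE (vp x j).
have xP0 : ~ in_P0 g (val x) by case=> j xj; have := xN j; rewrite xj eqxx.
by rewrite GE // vG // addrAC subrr add0r mulKf // off_P0_deriv // mem_gP_P.
Qed.

End Linearization.

(** * Differentials of row-valued maps, by coordinates *)

Section Rows.
Set Implicit Arguments.
Unset Strict Implicit.
Variables (K : numFieldType) (m n : nat) (f : 'rV[K]_m -> 'rV[K]_n).
Variable x : 'rV[K]_m.

Lemma row_differentiable :
  (forall j, differentiable (fun w => f w 0 j : K) x) -> differentiable f x.
Proof.
move=> fd; rewrite (_ : f = \sum_(j < n) (fun w => f w 0 j *: delta_mx 0 j)).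
  by apply: differentiable_sum => j; exact: differentiableZl.
apply/funext => w; rewrite fct_sumE; exact: row_sum_delta.
Qed.

Lemma diff_row_coord V j : differentiable f x ->
  'd f x V 0 j = 'd (fun w => f w 0 j : K) x V.
Proof.
move=> fd; rewrite -[fun w => f w 0 j]/((fun N : 'rV[K]_n => N 0 j : K) \o f).
rewrite [in RHS]diff_comp //; last exact: differentiable_coord.
by rewrite /= diff_coord.
Qed.

Lemma diff_row_coordB (a b : 'rV[K]_m -> K) V j :
  (fun w => f w 0 j : K) = a - b -> differentiable f x ->
  differentiable a x -> differentiable b x ->
  'd f x V 0 j = 'd a x V - 'd b x V.
Proof. by move=> fab fd ad bd; rewrite diff_row_coord // fab diffB. Qed.

End Rows.

(** * Comparison of ker DR with the fixed space of the transfer operator *)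

Section CriticalRelations.
Set Implicit Arguments.
Unset Strict Implicit.
Variables (C : numClosedFieldType) (nu : nat) (g : marked_map C nu).
Variables (D : deformation g) (r : nat) (q l : 'I_nu -> nat).
Variable mu : 'I_nu -> 'I_nu.
Hypothesis crit : critical_relations g r q l mu.
Hypothesis extra : extra_cycles_nonparabolic g.
Hypothesis mult : forall j : 'I_nu, (r <= j)%N ->
  derive1 (iter (q j - l j) g) (orb g (l j) j) != 1.
Local Notation c1 := (cvec g 1).
Local Notation gamma := (@gpt C nu g).
Implicit Types (x : gP g) (V : 'rV[C]_nu) (v u : {ffun gP g -> C}).

Lemma lifted_velocity_uniq V u v :
  lifted_velocity D u V -> lifted_velocity D v V -> u = v.
Proof.
move=> [up uG] [vp vG]; apply/ffunP => x; apply/eqP; rewrite -subr_eq0; apply/eqP.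
apply: (rigidity crit extra mult (v := fun x => u x - v x)) => {}x.
  by move=> [j xj]; rewrite (up x j) // (vp x j) // subrr.
by move=> xP0; rewrite uG // vG // mulrBr opprD addrACA subrr add0r.
Qed.

(** The left-hand side of the lifting equations; the terms depending on V form the right-hand
    side. *)
Definition defect_fun v : {ffun gP g -> C} :=
  [ffun x : gP g => if [pick j | val x == mm_c0 g j] is Some j then v x
                    else v (gamma x) - derive1 g (val x) * v x].

Lemma defect_fun_is_linear : linear defect_fun.
Proof.
move=> a u v; apply/ffunP => x; rewrite !ffunE.
have E (d s t s' t' : C) :
    a * s + t - d * (a * s' + t') = a * (s - d * s') + (t - d * t').
  by rewrite mulrDr opprD addrACA mulrBr mulrCA.
by case: pickP => [//|_]; exact: E.
Qed.

HB.instance Definition _ :=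
  GRing.isLinear.Build C {ffun gP g -> C} {ffun gP g -> C} _ defect_fun
    defect_fun_is_linear.

(* Rigidity makes the left-hand side of the lifting equations injective on a
   finite-dimensional space, hence onto. *)
Lemma lifted_velocity_exists V : exists v, lifted_velocity D v V.
Proof.
pose B : 'End({ffun gP g -> C}) := linfun defect_fun.
have pickN x : ~ in_P0 g (val x) -> [pick j | val x == mm_c0 g j] = None.
  move=> xP0; by case: pickP => // j /eqP xj; case: xP0; exists j.
have pickS x j : val x = mm_c0 g j -> [pick j | val x == mm_c0 g j] = Some j.
  move=> xj; case: pickP => [i|/(_ j)]; last by rewrite xj eqxx.
  by rewrite xj => /eqP/(@mm_c0_inj _ _ g) ->.
have /lker0_limgf Bfull : lker B == 0%VS.
  rewrite -subv0; apply/subvP => v; rewrite memv_ker memv0 => /eqP Bv.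
  have {}Bv x : defect_fun v x = 0 by rewrite -(lfunE defect_fun) Bv ffunE.
  apply/eqP/ffunP => x; rewrite ffunE.
  apply: (rigidity crit extra mult) => {}x.
    by move=> [j xj]; have := Bv x; rewrite ffunE (pickS x j).
  move=> xP0; have := Bv x; rewrite ffunE pickN // => /eqP.
  by rewrite subr_eq0 => /eqP.
pose b : {ffun gP g -> C} :=
  [ffun x : gP g => if [pick j | val x == mm_c0 g j] is Some j then pdot D j V
                    else Gdot D (val x) V].
have /memv_imgP[v _ bE] : b \in limg B by rewrite Bfull memvf.
have {}bE x : b x = defect_fun v x by rewrite bE lfunE.
exists v; split=> [x j xj|x xP0]; have := bE x; rewrite !ffunE.
  by rewrite (pickS x j).
by rewrite pickN // => ->; rewrite subrK.
Qed.

Lemma relation_off_P0 (j : 'I_nu) n : (n < q j)%N ->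
  forall k, (1 <= k <= n)%N -> ~ in_P0 g (orb g k j).
Proof.
move=> nq k /andP[k0 kn]; have [jr|rj] := ltnP j r.
  by have [_ _] := cr_a crit jr; apply; rewrite k0 (leq_ltn_trans kn).
have [_ _] := cr_b crit rj; apply; rewrite k0 (leq_trans kn) //; exact: ltnW.
Qed.

Lemma relation_q_gt0 j : (0 < q j)%N.
Proof.
have [jr|rj] := ltnP j r; first by case: (cr_a crit jr).
by have [/andP[_ /(leq_trans _)->//]] := cr_b crit rj.
Qed.

Definition relation_part (j : 'I_nu) : 'rV[C]_nu -> C :=
  if (j < r)%N then fun w => df_p D w 0 (mu j)
  else critical_orbit D (l j).-1 j.

Lemma Rmap_coord j : (fun w => Rmap D r q l mu w 0 j : C) =
  (critical_orbit D (q j).-1 j : 'rV[C]_nu -> C) - relation_part j.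
Proof.
by apply/funext => w; rewrite mxE /relation_part; case: ifP.
Qed.

Lemma relation_part_differentiable j : differentiable (relation_part j) c1.
Proof.
rewrite /relation_part; case: ltnP => [_|rj]; first exact: p_coord_differentiable.
apply: critical_orbit_differentiable; apply: relation_off_P0.
by have [/andP[_ lq] _ _] := cr_b crit rj; exact: leq_ltn_trans (leq_pred _) lq.
Qed.

Lemma relation_orbit_differentiable j :
  differentiable (critical_orbit D (q j).-1 j) c1.
Proof.
apply: critical_orbit_differentiable; apply: relation_off_P0.
by rewrite prednK // relation_q_gt0.
Qed.

Lemma Rmap_differentiable : differentiable (Rmap D r q l mu) c1.
Proof.
apply: row_differentiable => j; rewrite Rmap_coord.
apply: differentiableB; first exact: relation_orbit_differentiable.
exact: relation_part_differentiable.
Qed.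

Lemma diff_Rmap V j : 'd (Rmap D r q l mu) c1 V 0 j =
  'd (critical_orbit D (q j).-1 j) c1 V - 'd (relation_part j) c1 V.
Proof.
exact: diff_row_coordB (Rmap_coord j) Rmap_differentiable
  (relation_orbit_differentiable j) (relation_part_differentiable j).
Qed.

Definition gap V v (j : 'I_nu) n : C :=
  'd (critical_orbit D n j) c1 V - v (iter n gamma (c1pt g j)).

Lemma gap0 V v j : gap V v j 0 = V 0 j - v (c1pt g j).
Proof. by rewrite /gap /critical_orbit /= diff_coord. Qed.

(** The derivative of the critical orbit and [v] satisfy the same affine recursion, so the terms
    [Gdot] cancel in the difference. *)
Lemma gap_cocycle V v j m n : lifted_velocity D v V -> (m + n < q j)%N ->
  gap V v j (n + m) =
  derive1 (iter n g) (orb g m.+1 j) * gap V v j m.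
Proof.
move=> [_ vG] mnq.
have off i : (i < n)%N -> ~ in_P0 g (iter i g (orb g m.+1 j)).
  move=> ni; rewrite orb_iter; apply: (relation_off_P0 mnq).
  by rewrite addnS /= addnC ltn_add2l.
rewrite -[RHS](@cocycle_derive1 _ _ g (fun i => gap V v j (i + m))) // => i ni.
  by apply: off_P0_U; [rewrite orb_iter; exact: orb_P | exact: off].
have oE : iter i g (orb g m.+1 j) = orb g (i + m).+1 j by rewrite orb_iter addnS.
have := off i ni; rewrite oE => oP0.
rewrite addSn /gap diff_critical_orbitS /=; last first.
  apply: relation_off_P0; apply: leq_ltn_trans mnq.
  by rewrite -addSn addnC leq_add2l.
rewrite vG val_iter_gpt_c1pt //.
by rewrite opprD addrACA subrr add0r -mulrBr.
Qed.

Lemma diff_Rmap_eq0 V v : lifted_velocity D v V ->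
  'd (Rmap D r q l mu) c1 V = 0 <-> critical_values v = V.
Proof.
move=> vV; suff H j : 'd (Rmap D r q l mu) c1 V 0 j = 0 <-> v (c1pt g j) = V 0 j.
  split=> [RV|cV].
    by apply/rowP => j; rewrite mxE; apply/H; rewrite RV mxE.
  by apply/rowP => j; rewrite [RHS]mxE; apply/H; rewrite -cV mxE.
have q0 := relation_q_gt0 j.
have qE : val (iter (q j).-1 gamma (c1pt g j)) = orb g (q j) j.
  by rewrite val_iter_gpt_c1pt prednK.
have gapE : v (c1pt g j) = V 0 j <-> gap V v j 0 = 0.
  by rewrite gap0; split=> [->|/subr0_eq->//]; rewrite subrr.
have orb1_P n : (n < q j)%N -> derive1 (iter n g) (orb g 1 j) != 0.
  move=> nq; apply: derive1_iter_neq0; first exact: orb_P.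
  by move=> i ni; rewrite orb_iter addn1; apply: (relation_off_P0 nq).
rewrite gapE.
suff [a a0 ->] : exists2 a, a != 0 & 'd (Rmap D r q l mu) c1 V 0 j = a * gap V v j 0.
  by split=> [/eqP|->]; [rewrite mulf_eq0 (negbTE a0) => /eqP | rewrite mulr0].
rewrite diff_Rmap /relation_part; case: ltnP => [jr|rj].
  (* At index q_j - 1 the point is c_{q_j,j} = c_{0,mu(j)}, where [v] equals dp_{mu(j)}(V); so
     DR_j(V) is exactly the gap there. *)
  exists (derive1 (iter (q j).-1 g) (orb g 1 j)); first by rewrite orb1_P ?prednK.
  have [_ qmu _] := cr_a crit jr.
  rewrite -gap_cocycle ?add0n ?prednK // addn0 /gap.
  by rewrite (vV.1 _ (mu j)) // qE.
have [/andP[l0 lq] qlE _] := cr_b crit rj.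
have l1q : ((l j).-1 < q j)%N by rewrite prednK // ltnW.
(* Since c_{q_j,j} = c_{l_j,j}, the values of [v] cancel and DR_j(V) is the gap at q_j - 1 minus the
   gap at l_j - 1; the former is the latter times the multiplier of the cycle. *)
exists ((derive1 (iter (q j - l j) g) (orb g (l j) j) - 1) *
        derive1 (iter (l j).-1 g) (orb g 1 j)).
  by rewrite mulf_neq0 ?orb1_P // subr_eq0 mult.
rewrite -mulrA -gap_cocycle // addn0 mulrBl mul1r.
have qlE' : (q j - l j + (l j).-1 = (q j).-1)%N.
  by rewrite -(prednK l0) -(prednK q0) subSS /= subnK // -ltnS !prednK // ltnW.
have <- : gap V v j (q j).-1 =
    derive1 (iter (q j - l j) g) (orb g (l j) j) * gap V v j (l j).-1.
  by rewrite -qlE' gap_cocycle // ?(prednK l0) // addnC qlE' prednK.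
rewrite /gap (_ : iter (q j).-1 gamma (c1pt g j) = iter (l j).-1 gamma (c1pt g j)).
  by rewrite opprD opprK addrACA addNr addr0.
by apply: val_inj; rewrite qE qlE val_iter_gpt_c1pt prednK.
Qed.

Lemma leigenspace1E v :
  (v \in passmx.leigenspace (transfer_op D) 1) = (transfer_op D v == v).
Proof.
by rewrite memv_ker scale1r !lfun_simp subr_eq0.
Qed.

(** For V in the kernel, the velocity lifted from V has critical values V, so it is a fixed vector
    mapped to V. *)
Lemma ker_diff_Rmap :
  (linfun (@critical_values C nu g) @: passmx.leigenspace (transfer_op D) 1)%VS =
  lker (linfun ('d (Rmap D r q l mu) c1)).
Proof.
apply/eqP; rewrite eqEsubv; apply/andP; split; apply/subvP => V.
  move=> /memv_imgP[v]; rewrite leigenspace1E => /eqP/transfer_op_fixP vV ->.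
  by rewrite memv_ker !lfunE; apply/eqP; exact: (diff_Rmap_eq0 vV).2 erefl.
rewrite memv_ker lfunE => /eqP RV; have [v vV] := lifted_velocity_exists V.
have cV := (diff_Rmap_eq0 vV).1 RV; apply/memv_imgP; exists v; last by rewrite lfunE.
by rewrite leigenspace1E; apply/eqP/transfer_op_fixP; rewrite cV.
Qed.

(** A fixed vector vanishing at all c_{1,k} is lifted from V = 0, hence zero by uniqueness; so
    [critical_values] is injective on the eigenspace. *)
Lemma dim_ker_diff_Rmap : \dim (lker (linfun ('d (Rmap D r q l mu) c1))) =
  \dim (passmx.leigenspace (transfer_op D) 1).
Proof.
rewrite -ker_diff_Rmap; apply: limg_dim_eq; apply/eqP; rewrite -subv0.
apply/subvP => v; rewrite memv_cap leigenspace1E memv0.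
move=> /andP[/eqP/transfer_op_fixP vV]; rewrite memv_ker lfunE => /eqP v0.
apply/eqP; rewrite [critical_values v]v0 in vV; apply: lifted_velocity_uniq vV _.
by split=> [x j _|x _]; rewrite /pdot /Gdot linear0 !ffunE // mulr0 addr0.
Qed.

End CriticalRelations.

Theorem theorem4p1 (R : realType) (nu : nat) (g : marked_map (Cplx R) nu)
    (D : deformation g) (r : nat) (q l : 'I_nu -> nat) (mu : 'I_nu -> 'I_nu) :
  critical_relations g r q l mu ->
  extra_cycles_nonparabolic g ->
  (forall j : 'I_nu, (r <= j)%N ->
     derive1 (iter (q j - l j) g) (orb g (l j) j) != 1) ->
  (passmx.leigenvalue (transfer_op D) 1 <->
     \det (jacobian (Rmap D r q l mu) (cvec g 1)) = 0) /\
  \dim (lker (linfun ('d (Rmap D r q l mu) (cvec g 1)))) =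
    \dim (passmx.leigenspace (transfer_op D) 1).
Proof.
move=> crit extra mult; have dimE := dim_ker_diff_Rmap D crit extra mult.
(* The equality of dimensions turns a nonzero eigenspace into a nonzero kernel of DR. *)
split=> //; rewrite /passmx.leigenvalue -dimv_eq0 -dimE dimv_eq0.
set f := 'd (Rmap D r q l mu) (cvec g 1).
split=> [kf|/eqP/det0P[V V0]].
  apply/eqP/det0P; exists (vpick (lker (linfun f))); first by rewrite vpick0.
  rewrite mul_rV_lin1; apply/eqP.
  by have := memv_pick (lker (linfun f)); rewrite memv_ker lfunE.
rewrite mul_rV_lin1 => fV; apply: contraNneq V0 => kf.
by rewrite -memv0 -kf memv_ker lfunE /= fV.
Qed.
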